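(* Let $V=(\mathbb{F}_2)^6=V_1\times V_2$ with $V_1=V_2=(\mathbb{F}_2)^3$, and let $\lambda$, $\gamma$, $\circ'$ be the linear map, the bricklayer transformation and the sum on $V$ defined in the context. Then $\langle T_+,\lambda\gamma\rangle\subseteq\mathrm{AGL}(V,\circ')$, where $T_+=\{x\mapsto x+v\mid v\in V\}$ is the translation group with respect to the usual sum $+$ of $V$.
   Context: Vectors are row vectors. The map $\lambda:V\to V$ is $x\mapsto x\cdot\Lambda$ with $$\Lambda=\begin{bmatrix}0&1&1&0&1&0\\0&1&0&0&0&0\\1&1&1&0&1&0\\0&1&0&1&1&1\\0&0&0&0&1&0\\0&1&0&1&1&0\end{bmatrix}$$ over $\mathbb{F}_2$. The map $\gamma$ is $\gamma(v_1,v_2)=(\gamma_1(v_1),\gamma_2(v_2))$ for $v_1,v_2\in(\mathbb{F}_2)^3$, where $\gamma_1=\gamma_2$ is the map on $\mathbb{F}_{2^3}$ given by $$x\mapsto\alpha^5x^6+\alpha x^5+\alpha^2x^4+\alpha^5x^3+\alpha x^2+\alpha x,$$ with $\alpha$ a primitive element of $\mathbb{F}_{2^3}$ satisfying $\alpha^3=\alpha+1$, and $(\mathbb{F}_2)^3$ is identified with $\mathbb{F}_{2^3}$ via $(c_0,c_1,c_2)\leftrightarrow c_0+c_1\alpha+c_2\alpha^2$. The map $\lambda\gamma$ is the composition in which $\gamma$ is applied first. The sum $\circ$ on $(\mathbb{F}_2)^3$: let $T_\circ=\langle\tau_1,\tau_2,\tau_3\rangle\le\mathrm{Sym}((\mathbb{F}_2)^3)$,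 where $$\tau_1(x)=x\cdot\begin{bmatrix}1&0&0\\0&1&0\\0&1&1\end{bmatrix}+e_1,\quad \tau_2(x)=x+e_2,\quad \tau_3(x)=x\cdot\begin{bmatrix}1&1&0\\0&1&0\\0&0&1\end{bmatrix}+e_3,$$ with $e_1=(1,0,0)$, $e_2=(0,1,0)$, $e_3=(0,0,1)$. The group $T_\circ$ is elementary abelian and regular on $(\mathbb{F}_2)^3$; for $x,y\in(\mathbb{F}_2)^3$, $x\circ y$ is defined as $\tau(x)$, where $\tau$ is the unique element of $T_\circ$ with $\tau(0)=y$ (so $\tau_i(x)=x\circ e_i$). Then $((\mathbb{F}_2)^3,\circ)$ is the additive group of an $\mathbb{F}_2$-vector space with zero $0$. On $V$ put $(x_1,x_2)\circ'(y_1,y_2)=(x_1\circ y_1,x_2\circ y_2)$, which makes $(V,\circ')$ an $\mathbb{F}_2$-vector space. $\mathrm{AGL}(V,\circ')\le\mathrm{Sym}(V)$ is the group of maps $x\mapsto g(x)\circ' v$ with $g\in\mathrm{GL}(V,\circ')$ and $v\in V$. *)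

(* Defs.v *)
From HB Require Import structures.
From mathcomp Require Import all_boot all_order all_algebra all_fingroup all_field.
From mathcomp Require Import ring.

Set Implicit Arguments.
Unset Strict Implicit.
Unset Printing Implicit Defensive.

Import GRing.Theory.
Local Open Scope ring_scope.

Section Affine.
Variables (K : finFieldType) (W : finLmodType K).

Definition GL_perm : {set {perm W}} :=
  [set g : {perm W} | [forall a : K, forall x : W, forall y : W,
     g (a *: x + y) == a *: g x + g y]].

Definition AGL_perm : {set {perm W}} :=
  [set p : {perm W} | [exists g in GL_perm, exists v : W,
     [forall x : W, p x == g x + v]]].

Lemma GL_permP (g : {perm W}) : reflect (linear g) (g \in GL_perm).
Proof.
rewrite inE; apply: (iffP forallP) => [h a x y|h a].
  by move/forallP: (h a) => /(_ x) /forallP /(_ y) /eqP.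
by apply/forallP => x; apply/forallP => y; rewrite h.
Qed.

Lemma AGL_permP (p : {perm W}) :
  reflect (exists g : {perm W}, exists v : W,
             linear g /\ forall x, p x = g x + v)
          (p \in AGL_perm).
Proof.
rewrite inE; apply: (iffP exists_inP) => [[g gL /existsP[v /forallP gv]]|].
  exists g, v; split; first exact/GL_permP.
  by move=> x; apply/eqP.
case=> g [v [/GL_permP gL gv]]; exists g => //.
by apply/existsP; exists v; apply/forallP => x; rewrite gv.
Qed.

End Affine.

Notation V3 := 'rV['F_2]_3.
Notation V6 := 'rV['F_2]_(3 + 3).

Definition mx_of_rows m n (s : seq (seq 'F_2)) : 'M['F_2]_(m, n) :=
  \matrix_(i, j) nth 0 (nth [::] s i) j.

Definition vec3 (a b c : 'F_2) : V3 := \row_j [:: a; b; c]`_j.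

Definition e1 : V3 := vec3 1 0 0.
Definition e2 : V3 := vec3 0 1 0.
Definition e3 : V3 := vec3 0 0 1.

Lemma vec3_eta (x : V3) :
  x = vec3 (x 0 (inord 0)) (x 0 (inord 1)) (x 0 (inord 2)).
Proof.
apply/rowP => -[[|[|[|//]]] i]; rewrite mxE /=;
  by congr (x _ _); apply: val_inj; rewrite /= inordK.
Qed.

Lemma vec3_inj a b c a' b' c' :
  vec3 a b c = vec3 a' b' c' -> [/\ a = a', b = b' & c = c'].
Proof.
move=> /rowP e; split.
- by have := e (inord 0); rewrite !mxE inordK.
- by have := e (inord 1); rewrite !mxE inordK.
- by have := e (inord 2); rewrite !mxE inordK.
Qed.

Lemma vec3D a b c a' b' c' :
  vec3 a b c + vec3 a' b' c' = vec3 (a + a') (b + b') (c + c').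
Proof. by apply/rowP => -[[|[|[|//]]] i]; rewrite !mxE. Qed.

Lemma vec3_0 : vec3 0 0 0 = 0.
Proof. by apply/rowP => -[[|[|[|//]]] i]; rewrite !mxE. Qed.

Lemma vec3_mul a b c r1 r2 r3 s1 s2 s3 t1 t2 t3 :
  vec3 a b c *m mx_of_rows 3 3 [:: [:: r1; r2; r3]; [:: s1; s2; s3];
                                   [:: t1; t2; t3]]
  = vec3 (a * r1 + (b * s1 + c * t1)) (a * r2 + (b * s2 + c * t2))
         (a * r3 + (b * s3 + c * t3)).
Proof.
by apply/rowP => -[[|[|[|//]]] i];
   rewrite !mxE !big_ord_recl big_ord0 !mxE /= addr0.
Qed.

Lemma F2P (a : 'F_2) : a = 0 \/ a = 1.
Proof.
case: a => -[|[|//]] i; [left|right]; exact: val_inj.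
Qed.

Definition tau1_fun (x : V3) : V3 :=
  x *m mx_of_rows 3 3 [:: [:: 1; 0; 0]; [:: 0; 1; 0]; [:: 0; 1; 1]] + e1.
Definition tau2_fun (x : V3) : V3 := x + e2.
Definition tau3_fun (x : V3) : V3 :=
  x *m mx_of_rows 3 3 [:: [:: 1; 1; 0]; [:: 0; 1; 0]; [:: 0; 0; 1]] + e3.

Lemma tau1_funE a b c : tau1_fun (vec3 a b c) = vec3 (a + 1) (b + c) c.
Proof. by rewrite /tau1_fun vec3_mul vec3D; congr vec3; ring. Qed.

Lemma tau2_funE a b c : tau2_fun (vec3 a b c) = vec3 a (b + 1) c.
Proof. by rewrite /tau2_fun vec3D; congr vec3; ring. Qed.

Lemma tau3_funE a b c : tau3_fun (vec3 a b c) = vec3 a (a + b) (c + 1).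
Proof. by rewrite /tau3_fun vec3_mul vec3D; congr vec3; ring. Qed.

Lemma F2_addxx (a : 'F_2) : a + a = 0.
Proof. by case: (F2P a) => ->; apply: val_inj. Qed.

Lemma F2_addKx (a b : 'F_2) : a + (a + b) = b.
Proof. by rewrite addrA F2_addxx add0r. Qed.

Lemma tau1_funK : involutive tau1_fun.
Proof.
move=> x; rewrite [x]vec3_eta !tau1_funE.
by rewrite -!addrA !F2_addxx !addr0.
Qed.

Lemma tau2_funK : involutive tau2_fun.
Proof. by move=> x; rewrite [x]vec3_eta !tau2_funE -!addrA !F2_addxx !addr0. Qed.

Lemma tau3_funK : involutive tau3_fun.
Proof.
move=> x; rewrite [x]vec3_eta !tau3_funE.
by rewrite F2_addKx -!addrA !F2_addxx !addr0.
Qed.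

Definition tau1 : {perm V3} := perm (inv_inj tau1_funK).
Definition tau2 : {perm V3} := perm (inv_inj tau2_funK).
Definition tau3 : {perm V3} := perm (inv_inj tau3_funK).

Definition Tcirc : {group {perm V3}} := <<[set tau1; tau2; tau3]>>%G.

Lemma tau1E a b c : tau1 (vec3 a b c) = vec3 (a + 1) (b + c) c.
Proof. by rewrite permE tau1_funE. Qed.
Lemma tau2E a b c : tau2 (vec3 a b c) = vec3 a (b + 1) c.
Proof. by rewrite permE tau2_funE. Qed.
Lemma tau3E a b c : tau3 (vec3 a b c) = vec3 a (a + b) (c + 1).
Proof. by rewrite permE tau3_funE. Qed.
Definition tauE := (tau1E, tau2E, tau3E).

Lemma Tcirc_tau1 : tau1 \in Tcirc.
Proof. by rewrite mem_gen // !inE eqxx. Qed.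
Lemma Tcirc_tau2 : tau2 \in Tcirc.
Proof. by rewrite mem_gen // !inE eqxx orbT. Qed.
Lemma Tcirc_tau3 : tau3 \in Tcirc.
Proof. by rewrite mem_gen // !inE eqxx !orbT. Qed.

Lemma Tcirc_abelian : abelian Tcirc.
Proof.
rewrite abelian_gen; apply/centsP => s hs t ht.
have c12 : commute tau1 tau2.
  apply/permP => x; rewrite [x]vec3_eta !permM !tauE.
  by congr vec3; ring.
have c13 : commute tau1 tau3.
  apply/permP => x; rewrite [x]vec3_eta !permM !tauE.
  by congr vec3; ring.
have c23 : commute tau2 tau3.
  apply/permP => x; rewrite [x]vec3_eta !permM !tauE.
  by congr vec3; ring.
move: hs ht; rewrite !inE.
by move=> /orP[/orP[]|] /eqP-> /orP[/orP[]|] /eqP->.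
Qed.

Definition tau_word (a b c : 'F_2) : {perm V3} :=
  (tau1 ^+ a * (tau3 ^+ c * tau2 ^+ (b + a * c : 'F_2)%R))%g.

Lemma tau_word_in a b c : tau_word a b c \in Tcirc.
Proof.
by rewrite !groupM ?groupX ?Tcirc_tau1 ?Tcirc_tau2 ?Tcirc_tau3.
Qed.

Lemma tau_wordE a b c a' b' c' :
  tau_word a b c (vec3 a' b' c')
  = vec3 (a' + a) (b' + b + a' * c + c' * a) (c' + c).
Proof.
rewrite /tau_word !permM.
by case: (F2P a) (F2P b) (F2P c) (F2P a') (F2P b') (F2P c') =>
  -> [] -> [] -> [] -> [] -> [] ->; rewrite ?expg0 ?expg1 ?perm1 ?tauE;
  rewrite /= ?expg0 ?expg1 ?perm1 ?tauE; congr vec3; apply: val_inj.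
Qed.

Lemma Tcirc_transitive (y : V3) :
  exists t : {perm V3}, (t \in Tcirc) && (t 0 == y).
Proof.
rewrite [y]vec3_eta; set a := y _ _; set b := y _ _; set c := y _ _.
exists (tau_word a b c); rewrite tau_word_in -vec3_0 tau_wordE.
by apply/eqP; congr vec3; ring.
Qed.

Lemma Tcirc_free (s t : {perm V3}) :
  s \in Tcirc -> t \in Tcirc -> s 0 = t 0 -> s = t.
Proof.
move=> sT tT e; apply/permP => z.
have /andP[uT /eqP <-] := xchooseP (Tcirc_transitive z).
set u := xchoose _ in uT *.
have /centsP cT := Tcirc_abelian.
rewrite -(permM u s) -(permM u t) -(cT _ sT _ uT) -(cT _ tT _ uT).
by rewrite !permM e.
Qed.

(* The unique element of [Tcirc] mapping 0 to y (unique by [Tcirc_free]). *)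
Definition tau_to (y : V3) : {perm V3} := xchoose (Tcirc_transitive y).

Definition circ (x y : V3) : V3 := tau_to y x.

Lemma circE a b c a' b' c' :
  circ (vec3 a b c) (vec3 a' b' c')
  = vec3 (a + a') (b + b' + a * c' + c * a') (c + c').
Proof.
have -> : circ (vec3 a b c) (vec3 a' b' c') = tau_word a' b' c' (vec3 a b c).
  rewrite /circ; suff -> : tau_to (vec3 a' b' c') = tau_word a' b' c' by [].
  have /andP[uT /eqP u0] := xchooseP (Tcirc_transitive (vec3 a' b' c')).
  apply: Tcirc_free => //; first exact: tau_word_in.
  by rewrite u0 -vec3_0 tau_wordE; congr vec3; ring.
by rewrite tau_wordE.
Qed.

Lemma circA : associative circ.
Proof.
move=> x y z; rewrite [x]vec3_eta [y]vec3_eta [z]vec3_eta !circE.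
by congr vec3; ring.
Qed.

Lemma circC : commutative circ.
Proof.
by move=> x y; rewrite [x]vec3_eta [y]vec3_eta !circE; congr vec3; ring.
Qed.

Lemma circ0x : left_id 0 circ.
Proof.
by move=> x; rewrite [x]vec3_eta -vec3_0 !circE; congr vec3; ring.
Qed.

Lemma circxx x : circ x x = 0.
Proof.
rewrite [x]vec3_eta circE F2_addxx F2_addxx F2_addxx add0r.
by rewrite [X in _ + X]mulrC F2_addxx vec3_0.
Qed.

Definition circ2 (x y : V6) : V6 :=
  row_mx (circ (lsubmx x) (lsubmx y)) (circ (rsubmx x) (rsubmx y)).

Lemma circ2A : associative circ2.
Proof. by move=> x y z; rewrite /circ2 !row_mxKl !row_mxKr !circA. Qed.

Lemma circ2C : commutative circ2.
Proof. by move=> x y; rewrite /circ2 circC [X in row_mx _ X]circC. Qed.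

Lemma circ20x : left_id 0 circ2.
Proof. by move=> x; rewrite /circ2 !linear0 !circ0x hsubmxK. Qed.

Lemma circ2xx (x : V6) : circ2 x x = 0.
Proof. by rewrite /circ2 !circxx row_mx0. Qed.

Lemma circ2Nx : left_inverse 0 id circ2.
Proof. exact: circ2xx. Qed.

(* An alias of V carrying the sum [circ2] instead of the usual one. *)
Definition Vcirc : Type := V6.

HB.instance Definition _ := Finite.on Vcirc.
HB.instance Definition _ :=
  GRing.isZmodule.Build Vcirc circ2A circ2C circ20x circ2Nx.

Lemma Vcirc_addxx (x : Vcirc) : x + x = 0.
Proof. exact: circ2xx. Qed.

(* The a-fold sum for [circ2]: the only scaling of this group by 'F_2. *)
Definition Vcirc_scale (a : 'F_2) (x : Vcirc) : Vcirc := x *+ a.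

Lemma Vcirc_scaleA a b x :
  Vcirc_scale a (Vcirc_scale b x) = Vcirc_scale (a * b) x.
Proof.
by case: (F2P a) (F2P b) => -> [] ->; rewrite /Vcirc_scale /= ?mulr0n ?mulr1n.
Qed.

Lemma Vcirc_scale1 : left_id 1 Vcirc_scale.
Proof. by []. Qed.

Lemma Vcirc_scaleDr : right_distributive Vcirc_scale +%R.
Proof. by move=> a x y; rewrite /Vcirc_scale mulrnDl. Qed.

Lemma Vcirc_scaleDl x : {morph Vcirc_scale^~ x : a b / a + b}.
Proof.
by move=> a b; case: (F2P a) (F2P b) => -> [] ->;
  rewrite /Vcirc_scale /= ?mulr0n ?mulr1n ?addr0 ?add0r ?Vcirc_addxx.
Qed.

HB.instance Definition _ :=
  GRing.Zmodule_isLmodule.Build 'F_2 Vcirc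
    Vcirc_scaleA Vcirc_scale1 Vcirc_scaleDr Vcirc_scaleDl.

Definition transl (v : V6) : {perm V6} := perm (@addIr _ v).

Definition Tplus : {set {perm V6}} := [set transl v | v : V6].

Definition Lambda : 'M['F_2]_(3 + 3) :=
  mx_of_rows 6 6
    [:: [:: 0; 1; 1; 0; 1; 0];
        [:: 0; 1; 0; 0; 0; 0];
        [:: 1; 1; 1; 0; 1; 0];
        [:: 0; 1; 0; 1; 1; 1];
        [:: 0; 0; 0; 0; 1; 0];
        [:: 0; 1; 0; 1; 1; 0]].

Definition Lambda_inv : 'M['F_2]_(3 + 3) :=
  mx_of_rows 6 6
    [:: [:: 1; 0; 1; 0; 0; 0];
        [:: 0; 1; 0; 0; 0; 0];
        [:: 1; 1; 0; 0; 1; 0];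
        [:: 0; 1; 0; 0; 1; 1];
        [:: 0; 0; 0; 0; 1; 0];
        [:: 0; 0; 0; 1; 0; 1]].

Lemma LambdaK : Lambda *m Lambda_inv = 1%:M.
Proof.
apply/matrixP => i j; rewrite !mxE !big_ord_recl big_ord0 !mxE.
by case: i j => -[|[|[|[|[|[|//]]]]]] ? [] [|[|[|[|[|[|//]]]]]] ?;
  apply: val_inj.
Qed.

Definition lambda_fun (x : V6) : V6 := x *m Lambda.

Lemma lambda_inj : injective lambda_fun.
Proof.
by apply: (can_inj (g := mulmxr Lambda_inv)) => x;
  rewrite /= -mulmxA LambdaK mulmx1.
Qed.

Definition lambda : {perm V6} := perm lambda_inj.

Section Gamma.
Variables (F : fieldExtType 'F_2) (alpha : F).

Definition alpha_basis : 3.-tuple F := [tuple 1; alpha; alpha ^+ 2].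

(* F_8 is an arbitrary F of degree 3 over 'F_2; the degree and the primitivity
   of alpha are hypotheses where they are needed. *)
Definition to_F8 (c : V3) : F := \sum_(i < 3) c 0 i *: alpha_basis`_i.

(* Inverse of [to_F8] when \dim {:F} = 3: see [to_F8K] and [of_F8K]. *)
Definition of_F8 (z : F) : V3 := \row_i coord alpha_basis i z.

Definition gamma1_F8 (x : F) : F :=
  alpha ^+ 5 * x ^+ 6 + alpha * x ^+ 5 + alpha ^+ 2 * x ^+ 4
  + alpha ^+ 5 * x ^+ 3 + alpha * x ^+ 2 + alpha * x.

Definition gamma1 (c : V3) : V3 := of_F8 (gamma1_F8 (to_F8 c)).

Definition gamma_fun (x : V6) : V6 :=
  row_mx (gamma1 (lsubmx x)) (gamma1 (rsubmx x)).

Hypothesis alphaE : alpha ^+ 3 = alpha + 1.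

Lemma F8_addxx (x : F) : x + x = 0.
Proof. by rewrite -[x]scale1r -scalerDl F2_addxx scale0r. Qed.

Lemma to_F8_vec3 a b c :
  to_F8 (vec3 a b c) = a%:A + b%:A * alpha + c%:A * alpha ^+ 2.
Proof.
rewrite /to_F8 !big_ord_recl big_ord0 !mxE /= addr0 addrA.
by rewrite !mulr_algl.
Qed.

Lemma to_F8M a b c a' b' c' :
  to_F8 (vec3 a b c) * to_F8 (vec3 a' b' c')
  = to_F8 (vec3 (a * a' + (b * c' + c * b'))
                (a * b' + b * a' + (b * c' + c * b') + c * c')
                (a * c' + b * b' + c * a' + c * c')).
Proof.
rewrite !to_F8_vec3 -!/(in_alg F _) !(rmorphD, rmorphM) /=.
move: (a%:A) (b%:A) (c%:A) (a'%:A) (b'%:A) (c'%:A) => x y z x' y' z'.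
have red (p q r : F) : p = q + (alpha ^+ 3 - (alpha + 1)) * r -> p = q.
  by rewrite alphaE subrr mul0r addr0.
apply: (red _ _ ((y * z' + z * y') + z * z' * alpha)); ring.
Qed.

Lemma to_F8D x y : to_F8 (x + y) = to_F8 x + to_F8 y.
Proof.
by rewrite /to_F8 -big_split; apply: eq_bigr => i _; rewrite !mxE scalerDl.
Qed.

Lemma to_F8_1 : to_F8 (vec3 1 0 0) = 1.
Proof. by rewrite to_F8_vec3 !scale0r !mul0r !addr0 scale1r. Qed.

Lemma to_F8_alpha : to_F8 (vec3 0 1 0) = alpha.
Proof. by rewrite to_F8_vec3 !scale0r !mul0r addr0 add0r scale1r mul1r. Qed.

(* Coordinates of the product and of gamma1_F8, in a form that computes. *)
Let T3 : Type := ('F_2 * 'F_2 * 'F_2)%type.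
Let vec (p : T3) : V3 := vec3 p.1.1 p.1.2 p.2.
Let add3 (p q : T3) : T3 := (p.1.1 + q.1.1, p.1.2 + q.1.2, p.2 + q.2).
Let mul3 (p q : T3) : T3 :=
  let: (a, b, c) := p in let: (a', b', c') := q in
  (a * a' + (b * c' + c * b'),
   a * b' + b * a' + (b * c' + c * b') + c * c',
   a * c' + b * b' + c * a' + c * c').
Let exp3 (p : T3) (n : nat) : T3 := iter n (mul3 p) (1, 0, 0).
Let gamma3 (x : T3) : T3 :=
  let al := (0, 1, 0) in
  add3 (add3 (add3 (add3 (add3
    (mul3 (exp3 al 5) (exp3 x 6)) (mul3 al (exp3 x 5)))
    (mul3 (exp3 al 2) (exp3 x 4))) (mul3 (exp3 al 5) (exp3 x 3)))
    (mul3 al (exp3 x 2))) (mul3 al x).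

Let valM p q : to_F8 (vec (mul3 p q)) = to_F8 (vec p) * to_F8 (vec q).
Proof. by case: p q => [[a b] c] [[a' b'] c']; rewrite to_F8M. Qed.

Let valD p q : to_F8 (vec (add3 p q)) = to_F8 (vec p) + to_F8 (vec q).
Proof. by rewrite -to_F8D vec3D. Qed.

Let valX p n : to_F8 (vec (exp3 p n)) = to_F8 (vec p) ^+ n.
Proof.
elim: n => [|n IHn]; first exact: to_F8_1.
by rewrite /exp3 iterS valM IHn exprS.
Qed.

Let val_gamma p : to_F8 (vec (gamma3 p)) = gamma1_F8 (to_F8 (vec p)).
Proof. by rewrite !(valD, valM, valX) to_F8_alpha. Qed.

Let vecK (x : V3) : exists p, x = vec p.
Proof. by rewrite [x]vec3_eta; exists (x 0 (inord 0), x 0 (inord 1), x 0 (inord 2)). Qed.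

Lemma to_F8_eq0 (x : V3) : to_F8 x = 0 -> x = 0.
Proof.
have [p ->] := vecK x => p0.
have: (p == (0, 0, 0)) || (mul3 p (exp3 p 6) == (1, 0, 0)).
  move: p {p0} => [[a b] c].
  by case: (F2P a) (F2P b) (F2P c) => -> [] -> [] ->; vm_compute.
case/orP=> /eqP e; first by rewrite e; exact: vec3_0.
have := valM p (exp3 p 6).
by rewrite e p0 mul0r to_F8_1 => /eqP; rewrite oner_eq0.
Qed.

Lemma alpha_basis_free : free alpha_basis.
Proof.
apply/freeP => k k0 i.
have /rowP /(_ i) : \row_j k j = 0 :> V3.
  by apply: to_F8_eq0; rewrite -[RHS]k0; apply: eq_bigr => j _; rewrite mxE.
by rewrite !mxE.
Qed.

Lemma to_F8K : cancel to_F8 of_F8.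
Proof.
by move=> x; apply/rowP => i; rewrite mxE coord_sum_free ?alpha_basis_free.
Qed.

Lemma of_F8K : \dim {:F} = 3 -> cancel of_F8 to_F8.
Proof.
move=> dimF z; rewrite /to_F8 [RHS](@coord_basis _ _ {:F} _ alpha_basis).
- by apply: eq_bigr => i _; rewrite mxE.
- by rewrite basisEfree alpha_basis_free subvf size_tuple dimF.
- exact: memvf.
Qed.

Lemma gamma1_inj : injective gamma1.
Proof.
move=> x y; have [p ->] := vecK x; have [q ->] := vecK y.
rewrite /gamma1 -!val_gamma !to_F8K => e.
have {e} : gamma3 p = gamma3 q.
  by move: (gamma3 p) (gamma3 q) e => [[? ?] ?] [[? ?] ?] /vec3_inj[/=-> -> ->].
have inj3 : (gamma3 p == gamma3 q) ==> (p == q).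
  move: p q => [[a b] c] [[a' b'] c'].
  by case: (F2P a) (F2P b) (F2P c) (F2P a') (F2P b') (F2P c') =>
    -> [] -> [] -> [] -> [] -> [] ->; vm_compute.
by move=> e; move: inj3; rewrite e eqxx => /eqP ->.
Qed.

Lemma gamma_inj : injective gamma_fun.
Proof.
move=> x y /eq_row_mx[/gamma1_inj el /gamma1_inj er].
by rewrite -[x]hsubmxK -[y]hsubmxK el er.
Qed.

Definition gamma : {perm V6} := perm gamma_inj.

(* In [{perm V6}] the left factor of a product is applied first. *)
Definition lambda_gamma : {perm V6} := (gamma * lambda)%g.

Lemma lambda_gammaE x : lambda_gamma x = lambda_fun (gamma_fun x).
Proof. by rewrite permM !permE. Qed.

End Gamma.

(* Main.v *)
Require Import Defs.
From HB Require Import structures.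
From mathcomp Require Import all_boot all_order all_algebra all_fingroup all_field.
From mathcomp Require Import ring.

Set Implicit Arguments.
Unset Strict Implicit.
Unset Printing Implicit Defensive.

Import GRing.Theory.
Local Open Scope ring_scope.

(** The sum [circ] is the usual sum read in another coordinate system: in the
    formula [circE] the middle coordinate of a sum is off by the term
    a c' + c a', which is the polarisation of the quadratic form a c, so that
    (a, b, c) |-> (a, b + a c, c) is an isomorphism from the usual sum onto
    [circ].  Call it the chart ([chart], [circ_chart]); applied to both halves
    of V it is an isomorphism from the usual sum onto [circ2].

    A permutation of V is affine for [circ2] as soon as it is affine in the
    chart, and each generator of the group has degree one there:
    - a translation becomes an affine map ([chartD]): moving the point moves
      the quadratic term a c by a term of degree one;
    - on each half, the degree 6 polynomial defining gamma becomes the linear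
      map (a, b, c) |-> (b, a + b, a + c) ([gamma1_chart]);
    - lambda, which is linear for the usual sum, is again linear in the chart
      ([lambda_chart2]).
    As the affine permutations form a group ([AGL_perm_group_set]), it contains
    the group generated by these maps. *)

(** * Affine permutations *)

Section AffineGroup.
Variables (K : finFieldType) (W : finLmodType K).

Lemma AGL_perm_group_set : group_set (AGL_perm W).
Proof.
apply/group_setP; split.
  by apply/AGL_permP; exists 1%g, 0; split=> [a x y|x]; rewrite !perm1 ?addr0.
move=> p q /AGL_permP[g [v [gL pE]]] /AGL_permP[h [w [hL qE]]].
apply/AGL_permP; exists (g * h)%g, (h v + w); split=> [a x y|x].
  by rewrite !permM gL hL.
by rewrite !permM pE qE addrA -[g x]scale1r hL !scale1r.
Qed.

Canonical AGL_perm_group := Group AGL_perm_group_set.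

End AffineGroup.

(** Scalars in the prime field add no condition, so being affine can be
    tested on sums alone; the constant term is [p 0]. *)
Lemma AGL_perm_F2 (W : finLmodType 'F_2) (p : {perm W}) :
  (forall x y, p (x + y) + p 0 = p x + p y) -> p \in AGL_perm W.
Proof.
move=> pD; have g_inj : injective (fun x => p x - p 0).
  by move=> x y /addIr /perm_inj.
apply/AGL_permP; exists (perm g_inj), (p 0); split=> [a x y|x]; last first.
  by rewrite permE subrK.
rewrite !permE; case: (F2P a) => ->.
  by rewrite !scale0r !add0r.
by rewrite !scale1r -[p (x + y)](addrK (p 0)) pD [RHS]addrACA addrA.
Qed.

Lemma F2_mulxx (a : 'F_2) : a * a = a.
Proof. by case: (F2P a) => ->; rewrite ?mulr0 ?mulr1. Qed.

(** * The chart that linearises the sums *)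

Definition chart (a b c : 'F_2) : V3 := vec3 a (b + a * c) c.

Lemma chartP (x : V3) : exists a b c, x = chart a b c.
Proof.
rewrite [x]vec3_eta; set a := x 0 _; set b := x 0 _; set c := x 0 _.
exists a, (b + a * c), c.
by rewrite /chart -addrA F2_addxx addr0.
Qed.

Lemma chart0 : chart 0 0 0 = 0.
Proof. by rewrite /chart mulr0 addr0 vec3_0. Qed.

Lemma circ_chart a b c a' b' c' :
  circ (chart a b c) (chart a' b' c') = chart (a + a') (b + b') (c + c').
Proof. by rewrite /chart circE; congr vec3; ring. Qed.

Lemma chartD a b c u v w :
  chart a b c + vec3 u v w
  = chart (a + u) (b + v + (a * w + u * c + u * w)) (c + w).
Proof.
rewrite /chart vec3D; congr vec3; set s := _ + u * w.
transitivity (b + v + (s + (s + a * c))); last by rewrite /s; ring.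
by rewrite F2_addKx addrAC.
Qed.

Definition chart2 a b c d e f : V6 := row_mx (chart a b c) (chart d e f).

Lemma chart2P (x : V6) : exists a b c d e f, x = chart2 a b c d e f.
Proof.
have [a [b [c xl]]] := chartP (lsubmx x).
have [d [e [f xr]]] := chartP (rsubmx x).
by exists a, b, c, d, e, f; rewrite /chart2 -xl -xr hsubmxK.
Qed.

Lemma chart2_0 : chart2 0 0 0 0 0 0 = 0.
Proof. by rewrite /chart2 chart0 row_mx0. Qed.

Lemma circ2_chart2 a b c d e f a' b' c' d' e' f' :
  circ2 (chart2 a b c d e f) (chart2 a' b' c' d' e' f')
  = chart2 (a + a') (b + b') (c + c') (d + d') (e + e') (f + f').
Proof. by rewrite /circ2 !row_mxKl !row_mxKr !circ_chart. Qed.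

(** * The generators in the chart *)

(** Being affine for [circ2], transported through the chart: the sums are then
    coordinatewise.  Writing the condition with p 0 on the left avoids
    subtraction, so that for affine maps it holds in any commutative ring. *)
Lemma AGL_perm_circ2 (p : {perm V6}) :
  (forall a b c d e f a' b' c' d' e' f',
     circ2 (p (chart2 (a + a') (b + b') (c + c') (d + d') (e + e') (f + f')))
           (p (chart2 0 0 0 0 0 0))
     = circ2 (p (chart2 a b c d e f)) (p (chart2 a' b' c' d' e' f'))) ->
  p \in AGL_perm Vcirc.
Proof.
move=> pD; apply: (@AGL_perm_F2 Vcirc p) => x y.
(* The sums and the zero of this goal are those of [circ2]. *)
change (circ2 (p (circ2 x y)) (p 0) = circ2 (p x) (p y)).
have [a [b [c [d [e [f ->]]]]]] := chart2P x.
have [a' [b' [c' [d' [e' [f' ->]]]]]] := chart2P y.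
by rewrite -chart2_0 circ2_chart2 pD.
Qed.

Lemma transl_AGL (v : V6) : transl v \in AGL_perm Vcirc.
Proof.
apply: AGL_perm_circ2 => a b c d e f a' b' c' d' e' f'.
rewrite !permE -[v]hsubmxK [lsubmx v]vec3_eta [rsubmx v]vec3_eta.
rewrite /chart2 !add_row_mx !chartD.
by rewrite -!/(chart2 _ _ _ _ _ _) !circ2_chart2; congr chart2; ring.
Qed.

Lemma chart2_nth a b c d e f i :
  chart2 a b c d e f 0 i = [:: a; b + a * c; c; d; e + d * f; f]`_i.
Proof.
by rewrite mxE; case: splitP => -[[|[|[|//]]] ?] /= ->; rewrite mxE.
Qed.

(** Going back to the chart after [Lambda] subtracts the products of outer
    coordinates c (a + c) and (d + f) d; over the two-element field these are
    a c + c and d f + d, so they cancel the quadratic terms of the argument. *)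
Lemma lambda_chart2 a b c d e f :
  lambda_fun (chart2 a b c d e f)
  = chart2 c (a + b + d + f) (a + c) (d + f) (a + c + e + f) d.
Proof.
apply/rowP => j; rewrite mxE chart2_nth.
under eq_bigr do rewrite chart2_nth mxE.
rewrite !big_ord_recl big_ord0 /=.
case: j => -[|[|[|[|[|[|//]]]]]] ? /=.
all: ring: (F2_mulxx c) (F2_mulxx d).
Qed.

Lemma lambda_AGL : lambda \in AGL_perm Vcirc.
Proof.
apply: AGL_perm_circ2 => a b c d e f a' b' c' d' e' f'.
by rewrite !permE !lambda_chart2 !circ2_chart2; congr chart2; ring.
Qed.

Section Gamma.
Variables (F : fieldExtType 'F_2) (alpha : F).
Hypothesis alphaE : alpha ^+ 3 = alpha + 1.

Lemma to_F8_sqr a b c :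
  to_F8 alpha (vec3 a b c) ^+ 2 = to_F8 alpha (vec3 a c (b + c)).
Proof.
rewrite expr2 to_F8M //; congr (to_F8 _ (vec3 _ _ _));
  by case: (F2P a) (F2P b) (F2P c) => -> [] -> [] ->; apply: val_inj.
Qed.

(** The powers of x in [gamma1_F8] follow from squaring, which is linear, and
    the products x x^2, x x^4 and x^2 x^4; with the constants expanded on the basis of the
    powers of alpha, the claim becomes an identity of Boolean polynomials. *)
Lemma gamma1_chart a b c : gamma1 alpha (chart a b c) = chart b (a + b) (a + c).
Proof.
rewrite /gamma1 -[RHS](to_F8K alphaE); congr (of_F8 _ _); rewrite /gamma1_F8.
set x := to_F8 _ (chart a b c).
have x2 : x ^+ 2 = to_F8 alpha (vec3 a c (b + a * c + c)) by exact: to_F8_sqr.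
have x4 : x ^+ 4 = to_F8 alpha (vec3 a (b + a * c + c) (c + (b + a * c + c))).
  by rewrite (exprM x 2 2) x2 to_F8_sqr.
have alM p q r : alpha * to_F8 alpha (vec3 p q r) = to_F8 alpha (vec3 r (p + r) q).
  rewrite -[X in X * _](to_F8_alpha alpha) to_F8M //.
  by congr (to_F8 _ (vec3 _ _ _)); ring.
have al2 : alpha ^+ 2 = to_F8 alpha (vec3 0 0 1).
  by rewrite -[X in X ^+ 2](to_F8_alpha alpha) to_F8_sqr addr0.
have al5 : alpha ^+ 5 = to_F8 alpha (vec3 1 1 1).
  rewrite (exprD alpha 2 3) alphaE mulrDr mulr1 -exprSr alphaE to_F8_vec3.
  by rewrite !scale1r !mul1r [alpha + 1]addrC.
rewrite (exprD x 2 4) (exprS x 4) (exprS x 2) x4 x2 al2 al5.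
rewrite /x !(to_F8M alphaE, alM) -!to_F8D !vec3D.
by congr (to_F8 _ (vec3 _ _ _));
  case: (F2P a) (F2P b) (F2P c) => -> [] -> [] ->; apply: val_inj.
Qed.

Lemma gamma_AGL : gamma alphaE \in AGL_perm Vcirc.
Proof.
apply: AGL_perm_circ2 => a b c d e f a' b' c' d' e' f'.
rewrite !permE /gamma_fun /chart2 !row_mxKl !row_mxKr !gamma1_chart.
by rewrite -!/(chart2 _ _ _ _ _ _) !circ2_chart2; congr chart2; ring.
Qed.

End Gamma.

Theorem theorem5p1 (F : fieldExtType 'F_2) (dimF : \dim {:F} = 3%N)
    (alpha : F) (alpha_prim : 7.-primitive_root alpha)
    (alphaE : alpha ^+ 3 = alpha + 1) :
  (<<Tplus :|: [set lambda_gamma alphaE]>> \subset AGL_perm Vcirc)%g.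
Proof.
set S := _ :|: _.
suff: (S \subset AGL_perm_group Vcirc)%g by rewrite -gen_subG.
rewrite subUset sub1set; apply/andP; split.
  by apply/subsetP => _ /imsetP[v _ ->]; exact: transl_AGL.
exact: (groupM (gamma_AGL alphaE) lambda_AGL).
Qed.
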